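(* Assume: (A1) $A$ and $B$ are continuously differentiable and there exist $L_A,L_B\in(0,\infty)$ such that for all $x,\hat x\in\mathbb R^n$, $u,\hat u\in\mathbb R^m$, $\|A(x,u)-A(\hat x,\hat u)\|\le L_A(\|x-\hat x\|+\|u-\hat u\|)$ and $\|B(x,u)-B(\hat x,\hat u)\|\le L_B(\|x-\hat x\|+\|u-\hat u\|)$; (A2) there exist $\bar a,\bar b\in(0,\infty)$ such that $\sup_{x,u}\|A(x,u)\|\le\bar a$ and $\sup_{x,u}\|B(x,u)\|\le\bar b$; (A3) with $A_0=A(0,0)$, $B_0=B(0,0)$, the pair $(A_0,B_0)$ is stabilizable and the pair $(A_0,Q^{1/2})$ is detectable; and that $Q$ is positive definite, $0\in\mathrm{int}\,\mathcal X$, and $0\in\mathrm{int}\,\mathcal U$. Consider the system $x_{k+1}=f(x_k,u_k)$ under receding-horizon control $u_{k+1}=u_{k,1}$, where at each step $k\in\mathbb N$ the applied sequence $(u_{k,1},\ldots,u_{k,\ell-1})$ is a minimizer of ${\rm OCP}_k$. Then the equilibrium $z=0$ of the closed-loop dynamics $$z_{k+1}=\begin{bmatrix} f(x_k,u_k) \\ \kappa_{\rm mpc}(z_k) \end{bmatrix},\qquad z_k=\begin{bmatrix} x_k \\ u_k \end{bmatrix},$$ is asymptotically stable, and, for all $z_0\in\mathcal F_\ell$, $\lim_{k\to\infty}z_k=0$.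
   Context: $\mathbb N=\{0,1,2,\ldots\}$; $\|\cdot\|$ is the Euclidean norm on vectors and the induced norm on matrices. System: $f(x,u)=A(x,u)x+B(x,u)u$ for all $x\in\mathbb R^n$, $u\in\mathbb R^m$, with $A:\mathbb R^n\times\mathbb R^m\to\mathbb R^{n\times n}$, $B:\mathbb R^n\times\mathbb R^m\to\mathbb R^{n\times m}$; $x_0,u_0$ are given. $\mathcal X\subseteq\mathbb R^n$ and $\mathcal U\subseteq\mathbb R^m$ are closed. The horizon is an integer $\ell\ge2$. $Q\in\mathbb R^{n\times n}$ and $R\in\mathbb R^{m\times m}$ are symmetric, $R$ positive definite. Terminal ingredients: $P$ is the unique (positive definite) stabilizing solution of $P=A_0^TPA_0-A_0^TPB_0(2R+B_0^TPB_0)^{-1}B_0^TPA_0+2Q$; $K_{\rm f}=-(2R+B_0^TPB_0)^{-1}B_0^TPA_0$; $\kappa_{\rm f}(x)=K_{\rm f}x$; $V_{\rm f}(x)=x^TPx$; and $\mathcal X_{\rm f}=\{x\in\mathbb R^n:V_{\rm f}(x)\le\alpha\}$, where $\alpha\in(0,\infty)$ is such that (i) $\mathcal X_{\rm f}\subseteq\mathcal X$ and $\kappa_{\rm f}(x)\in\mathcal U$ for all $x\in\mathcal X_{\rm f}$; (ii) $f(x,\kappa_{\rm f}(x))\in\mathcal X_{\rm f}$ for all $x\in\mathcal X_{\rm f}$; (iii) $V_{\rm f}(f(x,\kappa_{\rm f}(x)))-V_{\rm f}(x)\le-x^TQx-\kappa_{\rm f}(x)^TR\kappa_{\rm f}(x)$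 for all $x\in\mathcal X_{\rm f}$. (Under the stated assumptions such an $\alpha$ exists.) Optimal control problem: given $(x_k,u_k)$, set $x_{k,1}=f(x_k,u_k)$ (so the first predicted state is not influenced by the optimization, and $x_{k+1}=x_{k,1}$). ${\rm OCP}_k$ is: minimize over $(u_{k,1},\ldots,u_{k,\ell-1})$ the cost $J_k=\tfrac12x_{k,\ell}^TPx_{k,\ell}+\tfrac12\sum_{j=1}^{\ell-1}(x_{k,j}^TQx_{k,j}+u_{k,j}^TRu_{k,j})$ subject to $x_{k,j+1}=f(x_{k,j},u_{k,j})$ for $j\in\{1,\ldots,\ell-1\}$, $x_{k,j}\in\mathcal X$ for $j\in\{1,\ldots,\ell\}$, $u_{k,j}\in\mathcal U$ for $j\in\{1,\ldots,\ell-1\}$, and $x_{k,\ell}\in\mathcal X_{\rm f}$. $\kappa_{\rm mpc}(z_k)=u_{k,1}$ denotes the first element of the applied (minimizing) sequence. Feasible set: $\mathcal F_\ell$ is the set of $(x,u)\in\mathbb R^{n+m}$ for which there exist $u_1,\ldots,u_{\ell-1}\in\mathcal U$ such that, with $x_1=f(x,u)$ and $x_{j+1}=f(x_j,u_j)$, one has $x_j\in\mathcal X$ for all $j\in\{1,\ldots,\ell-1\}$ and $x_\ell\in\mathcal X_{\rm f}$. The closed-loop dynamics are considered on $\mathcal F_\ell$. *)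

(* Defs.v *)
From HB Require Import structures.
From mathcomp Require Import all_boot all_order all_algebra.
From mathcomp Require Import all_classical all_reals all_analysis.
From mathcomp Require Import complex.

Set Implicit Arguments.
Unset Strict Implicit.
Unset Printing Implicit Defensive.

Import Order.TTheory GRing.Theory Num.Theory.
Import numFieldNormedType.Exports.

Local Open Scope classical_set_scope.
Local Open Scope ring_scope.

(* The library norm on matrices is the entrywise maximum; the Euclidean norm
   and the matrix norm it induces are defined here.  Topological notions
   (closed, interior, convergence, differentiability) use the library's
   topology, which is the same for all these norms. *)
Definition enorm (R : realType) (n : nat) (x : 'cV[R]_n) : R :=
  Num.sqrt (\sum_(i < n) x i 0 ^+ 2).

Definition opnorm (R : realType) (p n : nat) (M : 'M[R]_(p, n)) : R :=
  sup [set enorm (M *m x) | x in [set x : 'cV[R]_n | enorm x <= 1]].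

Definition qform (R : realType) (n : nat) (M : 'M[R]_n) (x : 'cV[R]_n) : R :=
  (x^T *m M *m x) 0 0.

Definition posdef (R : realType) (n : nat) (M : 'M[R]_n) : Prop :=
  M^T = M /\ forall x : 'cV[R]_n, x != 0 -> 0 < qform M x.

Definition possemidef (R : realType) (n : nat) (M : 'M[R]_n) : Prop :=
  M^T = M /\ forall x : 'cV[R]_n, 0 <= qform M x.

(* The positive semidefinite square root M^(1/2); it exists and is unique when
   M is positive semidefinite, and the default value 0 is irrelevant then. *)
Definition mxsqrt (R : realType) (n : nat) (M : 'M[R]_n) : 'M[R]_n :=
  xget 0 [set S : 'M[R]_n | possemidef S /\ S *m S = M].

(* All complex eigenvalues lie in the open unit disc (discrete time). *)
Definition schur_stable (R : realType) (n : nat) (M : 'M[R]_n) : Prop :=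
  forall lambda : R[i],
    eigenvalue (map_mx (real_complex R) M) lambda -> `|lambda| < 1.

Definition stabilizable (R : realType) (n m : nat)
    (A0 : 'M[R]_n) (B0 : 'M[R]_(n, m)) : Prop :=
  exists K : 'M[R]_(m, n), schur_stable (A0 + B0 *m K).

Definition detectable (R : realType) (n p : nat)
    (A0 : 'M[R]_n) (C0 : 'M[R]_(p, n)) : Prop :=
  exists L : 'M[R]_(n, p), schur_stable (A0 + L *m C0).

(* The last clause is continuity of the derivative in operator norm. *)
Definition continuously_differentiable (R : realType) (V W : normedModType R)
    (g : V -> W) : Prop :=
  (forall z, differentiable g z) /\
  (forall (z : V) (e : R), 0 < e ->
     \forall w \near z, forall v : V, `|'d g w v - 'd g z v| <= e * `|v|).

Definition lqr_gain (R : realType) (n m : nat)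
    (A0 : 'M[R]_n) (B0 : 'M[R]_(n, m)) (Rw : 'M[R]_m) (P : 'M[R]_n) :
    'M[R]_(m, n) :=
  - (invmx (2 *: Rw + B0^T *m P *m B0) *m B0^T *m P *m A0).

(* P is positive definite, solves the discrete algebraic Riccati equation with
   weights 2Q and 2Rw (the cost carries a factor 1/2 on every term), and its
   gain is stabilizing. *)
Definition stabilizing_solution (R : realType) (n m : nat)
    (A0 : 'M[R]_n) (B0 : 'M[R]_(n, m)) (Q : 'M[R]_n) (Rw : 'M[R]_m)
    (P : 'M[R]_n) : Prop :=
  [/\ posdef P,
      P = A0^T *m P *m A0
          - A0^T *m P *m B0 *m invmx (2 *: Rw + B0^T *m P *m B0)
            *m B0^T *m P *m A0
          + 2 *: Q
    & schur_stable (A0 + B0 *m lqr_gain A0 B0 Rw P)].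

Definition quasilinear (R : realType) (n m : nat)
    (A : 'cV[R]_n -> 'cV[R]_m -> 'M[R]_n)
    (B : 'cV[R]_n -> 'cV[R]_m -> 'M[R]_(n, m))
    (x : 'cV[R]_n) (u : 'cV[R]_m) : 'cV[R]_n :=
  A x u *m x + B x u *m u.

Definition ellipsoid (R : realType) (n : nat) (P : 'M[R]_n) (alpha : R) :
    set 'cV[R]_n :=
  [set x | qform P x <= alpha].

(* The predicted states x_j: x_0 = x, x_1 = f x u and x_(j+1) = f x_j (v j) for
   j >= 1.  An input sequence (v 1, ..., v (l - 1)) is encoded as a function on
   nat of which only these values are ever used; in particular v 0 is not, the
   first input being the given u. *)
Fixpoint pred_state (R : realType) (n m : nat)
    (f : 'cV[R]_n -> 'cV[R]_m -> 'cV[R]_n)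
    (x : 'cV[R]_n) (u : 'cV[R]_m) (v : nat -> 'cV[R]_m) (j : nat) :
    'cV[R]_n :=
  if j is j'.+1
  then f (pred_state f x u v j') (if j' is 0 then u else v j')
  else x.

Definition ocp_cost (R : realType) (n m : nat)
    (f : 'cV[R]_n -> 'cV[R]_m -> 'cV[R]_n)
    (Q : 'M[R]_n) (Rw : 'M[R]_m) (P : 'M[R]_n) (l : nat)
    (x : 'cV[R]_n) (u : 'cV[R]_m) (v : nat -> 'cV[R]_m) : R :=
  2^-1 * qform P (pred_state f x u v l)
  + 2^-1 * \sum_(1 <= j < l)
             (qform Q (pred_state f x u v j) + qform Rw (v j)).

Definition ocp_feasible (R : realType) (n m : nat)
    (f : 'cV[R]_n -> 'cV[R]_m -> 'cV[R]_n)
    (X : set 'cV[R]_n) (U : set 'cV[R]_m) (Xf : set 'cV[R]_n) (l : nat)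
    (x : 'cV[R]_n) (u : 'cV[R]_m) (v : nat -> 'cV[R]_m) : Prop :=
  [/\ forall j, (1 <= j <= l)%N -> X (pred_state f x u v j),
      forall j, (1 <= j < l)%N -> U (v j)
    & Xf (pred_state f x u v l)].

Definition ocp_minimizer (R : realType) (n m : nat)
    (f : 'cV[R]_n -> 'cV[R]_m -> 'cV[R]_n)
    (X : set 'cV[R]_n) (U : set 'cV[R]_m) (Xf : set 'cV[R]_n)
    (Q : 'M[R]_n) (Rw : 'M[R]_m) (P : 'M[R]_n) (l : nat)
    (x : 'cV[R]_n) (u : 'cV[R]_m) (v : nat -> 'cV[R]_m) : Prop :=
  ocp_feasible f X U Xf l x u v /\
  forall w, ocp_feasible f X U Xf l x u w ->
    ocp_cost f Q Rw P l x u v <= ocp_cost f Q Rw P l x u w.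

(* The extended state (x, u) is stacked: x = usubmx z and u = dsubmx z. *)
Definition feasible_set (R : realType) (n m : nat)
    (f : 'cV[R]_n -> 'cV[R]_m -> 'cV[R]_n)
    (X : set 'cV[R]_n) (U : set 'cV[R]_m) (Xf : set 'cV[R]_n) (l : nat) :
    set 'cV[R]_(n + m) :=
  [set z | exists v : nat -> 'cV[R]_m,
    [/\ forall j, (1 <= j < l)%N -> U (v j),
        forall j, (1 <= j < l)%N ->
          X (pred_state f (usubmx z) (dsubmx z) v j)
      & Xf (pred_state f (usubmx z) (dsubmx z) v l)]].

(* kappa is a receding-horizon law: it selects, at every point of the feasible
   set, the first element of some minimizer.  Minimizers need not be unique;
   nothing is assumed of the selection. *)
Definition mpc_law (R : realType) (n m : nat)
    (f : 'cV[R]_n -> 'cV[R]_m -> 'cV[R]_n)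
    (X : set 'cV[R]_n) (U : set 'cV[R]_m) (Xf : set 'cV[R]_n)
    (Q : 'M[R]_n) (Rw : 'M[R]_m) (P : 'M[R]_n) (l : nat)
    (kappa : 'cV[R]_(n + m) -> 'cV[R]_m) : Prop :=
  forall z, feasible_set f X U Xf l z ->
    exists2 v : nat -> 'cV[R]_m,
      ocp_minimizer f X U Xf Q Rw P l (usubmx z) (dsubmx z) v
      & kappa z = v 1%N.

Definition closed_loop (R : realType) (n m : nat)
    (f : 'cV[R]_n -> 'cV[R]_m -> 'cV[R]_n)
    (kappa : 'cV[R]_(n + m) -> 'cV[R]_m) (z : 'cV[R]_(n + m)) :
    'cV[R]_(n + m) :=
  col_mx (f (usubmx z) (dsubmx z)) (kappa z).

(* 0 is an asymptotically stable equilibrium of z+ = g z considered on D: D is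
   positively invariant (so that the dynamics are indeed dynamics on D), and 0
   is a fixed point in D that is Lyapunov stable and locally attractive. *)
Definition asymptotically_stable (R : realType) (N : nat)
    (D : set 'cV[R]_N) (g : 'cV[R]_N -> 'cV[R]_N) : Prop :=
  [/\ D 0 /\ g 0 = 0,
      forall z, D z -> D (g z),
      forall e : R, 0 < e -> exists2 d : R, 0 < d &
        forall z, D z -> enorm z < d -> forall k, enorm (iter k g z) < e
    & exists2 d : R, 0 < d &
        forall z, D z -> enorm z < d -> iter k g z @[k --> \oo] --> (0 : 'cV[R]_N)].

(* Main.v *)
Require Import Defs.
From HB Require Import structures.
From mathcomp Require Import all_boot all_order all_algebra.
From mathcomp Require Import all_classical all_reals all_analysis.
From mathcomp Require Import complex ring lra.

Set Implicit Arguments.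
Unset Strict Implicit.
Unset Printing Implicit Defensive.

Import Order.TTheory GRing.Theory Num.Theory.
Import numFieldNormedType.Exports.

Local Open Scope classical_set_scope.
Local Open Scope ring_scope.

(** The optimal value of the control problem is a Lyapunov function for the
    extended state z = (x, u).

    Let v be optimal at z, with predicted states x_1 = f x u, ..., x_l.  The
    closed loop moves to z' = (x_1, v_1), where the sequence v_2, ...,
    v_(l-1) completed by the terminal control at x_l is feasible
    ([shifted_feasible]).  It drops the stage (x_1, v_1) and appends a stage
    that the decrease of the terminal cost pays for ([shifted_cost]).  Hence
    V z' + (1/2) (|x_1|_Q^2 + |v_1|_R^2) <= V z: the decrease is measured by the
    successor z', both components of which are penalized, so positive
    definiteness of Q and R turns it into V z' + c |z'|^2 <= V z.

    For small z the state f x u lies in the terminal ellipsoid, because A and B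
    are bounded; using the terminal controller throughout then costs at most
    half of the terminal cost of f x u ([terminal_rollout_cost]), which gives
    V z <= G |z|^2.

    These two inequalities and V >= 0 imply everything ([lyapunov_stability]).
    Summing the first along a trajectory makes |z_k|^2 summable, so z_k tends
    to 0 from every feasible point.  It also gives c |z_k|^2 <= V z_0 for k >= 1,
    which with the second inequality is Lyapunov stability.  At z = 0 they read
    c |g 0|^2 <= V 0 <= 0, so 0 is a fixed point of the closed loop g whichever
    minimizer the control law selects. *)

(** * Euclidean norm, induced norm and quadratic forms *)

Lemma enorm_ge0 (R : realType) (n : nat) (x : 'cV[R]_n) : 0 <= enorm x.
Proof. exact: sqrtr_ge0. Qed.

Lemma sqr_enorm (R : realType) (n : nat) (x : 'cV[R]_n) :
  enorm x ^+ 2 = \sum_(i < n) x i 0 ^+ 2.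
Proof. by rewrite sqr_sqrtr// sumr_ge0// => i _; exact: sqr_ge0. Qed.

Lemma enorm0 (R : realType) (n : nat) : enorm (0 : 'cV[R]_n) = 0.
Proof.
by rewrite /enorm big1 ?sqrtr0// => i _; rewrite mxE expr0n.
Qed.

Lemma enormZ (R : realType) (n : nat) (a : R) (x : 'cV[R]_n) :
  enorm (a *: x) = `|a| * enorm x.
Proof.
rewrite /enorm -sqrtr_sqr -sqrtrM ?sqr_ge0// mulr_sumr.
by congr Num.sqrt; apply: eq_bigr => i _; rewrite mxE exprMn.
Qed.

Lemma enorm_eq0 (R : realType) (n : nat) (x : 'cV[R]_n) :
  enorm x = 0 -> x = 0.
Proof.
move=> x0; have := sqr_enorm x; rewrite x0 expr0n/= => /esym/eqP.
rewrite psumr_eq0 => [/allP h|i _]; last exact: sqr_ge0.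
apply/colP => i; rewrite mxE; apply/eqP.
by have := h i (mem_index_enum i); rewrite /= sqrf_eq0.
Qed.

Lemma coord_le_enorm (R : realType) (n : nat) (x : 'cV[R]_n) (i : 'I_n) :
  `|x i 0| <= enorm x.
Proof.
rewrite -[leLHS]sqrtr_sqr ler_wsqrtr//.
by rewrite (bigD1 i)//= lerDl sumr_ge0// => j _; exact: sqr_ge0.
Qed.

Lemma enorm_le_sum (R : realType) (n : nat) (x : 'cV[R]_n) :
  enorm x <= \sum_(i < n) `|x i 0|.
Proof.
have s0 : 0 <= \sum_(i < n) `|x i 0| by exact: sumr_ge0.
rewrite -(ler_pXn2r (n := 2)) ?nnegrE ?enorm_ge0// sqr_enorm expr2 mulr_suml.
apply: ler_sum => i _; rewrite -real_normK ?num_real// expr2.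
by rewrite ler_wpM2l// (bigD1 i)//= lerDl sumr_ge0.
Qed.

Lemma sqr_enorm_stack (R : realType) (n m : nat) (z : 'cV[R]_(n + m)) :
  enorm z ^+ 2 = enorm (usubmx z) ^+ 2 + enorm (dsubmx z) ^+ 2.
Proof.
rewrite !sqr_enorm big_split_ord/=.
by congr (_ + _); apply: eq_bigr => i _; rewrite mxE.
Qed.

Lemma norm_le_enorm (R : realType) (n : nat) (x : 'cV[R]_n) : `|x| <= enorm x.
Proof.
rewrite {1}/Num.norm/= mx_normrE; apply: bigmax_le => [|[i j] _ /=].
  exact: enorm_ge0.
by rewrite ord1; exact: coord_le_enorm.
Qed.

Lemma enorm_mulmx_le (R : realType) (p n : nat) (M : 'M[R]_(p, n))
    (x : 'cV[R]_n) :
  enorm (M *m x) <= (\sum_i \sum_j `|M i j|) * enorm x.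
Proof.
apply: (le_trans (enorm_le_sum _)); rewrite mulr_suml; apply: ler_sum => i _.
rewrite mxE (le_trans (ler_norm_sum _ _ _))// mulr_suml; apply: ler_sum => j _.
by rewrite normrM ler_wpM2l// coord_le_enorm.
Qed.

(** The supremum defining the induced norm is that of a bounded set, so it is
    a genuine upper bound; the general case follows by normalizing x. *)
Lemma enorm_mulmx_opnorm (R : realType) (p n : nat) (M : 'M[R]_(p, n))
    (x : 'cV[R]_n) :
  enorm (M *m x) <= opnorm M * enorm x.
Proof.
have [x0|x_neq0] := eqVneq (enorm x) 0.
  by rewrite x0 (enorm_eq0 x0) mulmx0 enorm0 mulr0.
have x_gt0 : 0 < enorm x by rewrite lt_def x_neq0 enorm_ge0.
rewrite -ler_pdivrMr//.
have -> : enorm (M *m x) / enorm x = enorm (M *m ((enorm x)^-1 *: x)).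
  by rewrite -scalemxAr enormZ ger0_norm ?invr_ge0 ?enorm_ge0// mulrC.
apply: ub_le_sup; last first.
  exists ((enorm x)^-1 *: x) => //=.
  by rewrite enormZ ger0_norm ?invr_ge0 ?enorm_ge0// mulVf.
exists (\sum_i \sum_j `|M i j|) => _ [y /= y1 <-].
apply: (le_trans (enorm_mulmx_le _ _)).
by rewrite ler_piMr// sumr_ge0// => i _; rewrite sumr_ge0.
Qed.

Lemma qformE (R : realType) (n : nat) (M : 'M[R]_n) (x : 'cV[R]_n) :
  qform M x = \sum_i \sum_j x i 0 * M i j * x j 0.
Proof.
rewrite /qform mxE exchange_big/=; apply: eq_bigr => j _.
by rewrite mxE mulr_suml; apply: eq_bigr => i _; rewrite mxE.
Qed.

Lemma qform0 (R : realType) (n : nat) (M : 'M[R]_n) : qform M 0 = 0.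
Proof. by rewrite /qform mulmx0 mxE. Qed.

Lemma posdef_qform_ge0 (R : realType) (n : nat) (M : 'M[R]_n) (x : 'cV[R]_n) :
  posdef M -> 0 <= qform M x.
Proof.
case=> _ M_gt0; have [->|x0] := eqVneq x 0; first by rewrite qform0.
exact/ltW/M_gt0.
Qed.

Lemma qform_ub (R : realType) (n : nat) (M : 'M[R]_n) (x : 'cV[R]_n) (r : R) :
  (forall i, `|x i 0| <= r) ->
  qform M x <= (\sum_i \sum_j `|M i j|) * r ^+ 2.
Proof.
move=> xr; rewrite qformE mulr_suml; apply: ler_sum => i _.
rewrite mulr_suml; apply: ler_sum => j _; apply: (le_trans (ler_norm _)).
rewrite !normrM mulrC mulrA mulrC expr2 ler_wpM2l//.
by rewrite ler_pM.
Qed.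

Lemma posdef_unitmx (R : realType) (n : nat) (M : 'M[R]_n) :
  posdef M -> M \in unitmx.
Proof.
case=> Msym M_gt0; rewrite -row_free_unit -kermx_eq0; apply: contraT => /rowV0Pn.
case=> v /sub_kermxP vM v0.
have /M_gt0 : v^T != 0 by rewrite trmx_eq0.
by rewrite /qform trmxK vM mul0mx mxE ltxx.
Qed.

(** For the inner product defined by M, the i-th column y of the inverse of M
    represents the coordinate x_i, and its square norm is a, the i-th diagonal
    entry of the inverse.  The bound is thus the Cauchy-Schwarz inequality,
    obtained from the positivity of M at x - (x_i / a) y. *)
Lemma posdef_coord_le (R : realType) (n : nat) (M : 'M[R]_n) (x : 'cV[R]_n)
    (i : 'I_n) :
  posdef M -> 0 < invmx M i i /\ x i 0 ^+ 2 <= invmx M i i * qform M x.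
Proof.
move=> Mpd; have Mu := posdef_unitmx Mpd; case: (Mpd) => Msym M_gt0.
pose e : 'cV[R]_n := delta_mx i 0; pose y := invmx M *m e.
have My : M *m y = e by rewrite mulKVmx.
have yM : y^T *m M = e^T by rewrite -{1}Msym -trmx_mul My.
have pick (w : 'cV[R]_n) : (e^T *m w) 0 0 = w i 0.
  by rewrite /e trmx_delta -rowE mxE.
have yi : y i 0 = invmx M i i by rewrite /y -colE mxE.
have qy : qform M y = invmx M i i by rewrite /qform yM pick yi.
have a_gt0 : 0 < invmx M i i.
  rewrite -qy M_gt0//; apply/eqP => y0.
  have : e i 0 = 0 by rewrite -My y0 mulmx0 mxE.
  by rewrite mxE !eqxx => /eqP; rewrite oner_eq0.
split=> //; set a := invmx M i i in yi qy a_gt0 *.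
have xMy : (x^T *m M *m y) 0 0 = x i 0.
  by rewrite -mulmxA My -(pick x) -[in LHS](trmxK e) -trmx_mul mxE.
pose t := x i 0 / a.
have := posdef_qform_ge0 (x - t *: y) Mpd.
have -> : qform M (x - t *: y) = qform M x - 2 * t * x i 0 + t ^+ 2 * a.
  have -> : qform M (x - t *: y) = (x^T *m M *m x - t *: (x^T *m M *m y)
      - (t *: (y^T *m M *m x) - (t * t) *: (y^T *m M *m y))) 0 0.
    have xtyT : (x - t *: y)^T = x^T - t *: y^T by rewrite linearB linearZ.
    rewrite /qform xtyT !mulmxBl !mulmxBr -!scalemxAl -!scalemxAr.
    by rewrite scalerA.
  have yMx : (y^T *m M *m x) 0 0 = x i 0 by rewrite yM pick.
  move: xMy yMx qy; rewrite /qform.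
  move: (x^T *m M *m x) (x^T *m M *m y) (y^T *m M *m x) (y^T *m M *m y).
  by move=> p q q' s; rewrite !mxE => -> -> ->; ring.
have -> : qform M x - 2 * t * x i 0 + t ^+ 2 * a = qform M x - x i 0 ^+ 2 / a.
  by rewrite /t; field; rewrite gt_eqF.
by rewrite subr_ge0 ler_pdivrMr// mulrC.
Qed.

(** Summing the coordinate bounds gives the constant as the inverse of
    1 + tr (M^-1); the term 1 keeps it meaningful in dimension 0. *)
Lemma posdef_qform_lb (R : realType) (n : nat) (M : 'M[R]_n) :
  posdef M ->
  exists2 c : R, 0 < c & forall x, c * enorm x ^+ 2 <= qform M x.
Proof.
move=> Mpd; pose s := 1 + \sum_i invmx M i i.
have s_gt0 : 0 < s.
  rewrite ltr_pwDl// sumr_ge0// => i _.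
  by have [/ltW] := posdef_coord_le 0 i Mpd.
exists s^-1; first by rewrite invr_gt0.
move=> x; rewrite mulrC ler_pdivrMr// sqr_enorm /s mulrDr mulr1 mulr_sumr.
rewrite -[leLHS]add0r lerD ?posdef_qform_ge0//; apply: ler_sum => i _.
by rewrite mulrC; have [] := posdef_coord_le x i Mpd.
Qed.

(** * Lyapunov stability *)

(** V is nonincreasing and nonnegative along a trajectory, hence convergent, so
    its decrements, which dominate the squared norm of the next state, tend
    to 0.  Since the decrease is measured at the successor and V is nonnegative
    there, V z bounds c |g z|^2: this plays the part of the usual lower bound of
    V by the norm in the proof of stability. *)
Lemma lyapunov_stability (R : realType) (N : nat) (D : set 'cV[R]_N)
    (g : 'cV[R]_N -> 'cV[R]_N) (V : 'cV[R]_N -> R) (c G r : R) :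
  0 < c -> 0 <= G -> 0 < r ->
  D 0 -> (forall z, D z -> D (g z)) ->
  (forall z, D z -> 0 <= V z) ->
  (forall z, D z -> V (g z) + c * enorm (g z) ^+ 2 <= V z) ->
  (forall z, D z -> enorm z <= r -> V z <= G * enorm z ^+ 2) ->
  asymptotically_stable D g /\
  (forall z, D z -> iter k g z @[k --> \oo] --> (0 : 'cV[R]_N)).
Proof.
move=> c0 G0 r0 D0 Dg V0 Vdec Vub.
have Dit z k : D z -> D (iter k g z) by move=> Dz; elim: k => //= k; exact: Dg.
have Vit z k : D z -> V (iter k g z) <= V z.
  move=> Dz; elim: k => //= k; apply: le_trans.
  apply: le_trans (Vdec _ (Dit z k Dz)).
  by rewrite lerDl mulr_ge0 ?sqr_ge0// ltW.
have cvg0 z : D z -> iter k g z @[k --> \oo] --> (0 : 'cV[R]_N).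
  move=> Dz; pose W k := V (iter k g z).
  have Wcvg : cvgn W.
    apply: nonincreasing_is_cvgn.
      apply/nonincreasing_seqP => k.
      by have := Vit (iter k g z) 1%N (Dit z k Dz).
    by exists 0 => _ [k _ <-]; exact/V0/Dit.
  have dW : W k - W k.+1 @[k --> \oo] --> 0.
    rewrite -(subrr (limn W)); apply: cvgB => //.
    by rewrite (cvg_shiftS W).
  rewrite -(cvg_shiftS (fun k => iter k g z)).
  apply/cvgr0Pnorm_lt => e e0.
  have ce0 : 0 < c * e ^+ 2 by rewrite mulr_gt0// exprn_gt0.
  have /cvgr0Pnorm_lt/(_ _ ce0) := dW.
  apply: filterS => k dk; apply: (le_lt_trans (norm_le_enorm _)).
  rewrite -(ltr_pXn2r (n := 2)) ?nnegrE ?enorm_ge0 ?(ltW e0)//.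
  rewrite -(ltr_pM2l c0); apply: le_lt_trans dk.
  apply: le_trans (ler_norm _); rewrite lerBrDl.
  exact: Vdec (Dit z k Dz).
split=> //; split=> //; [split=> //| |exists 1 => // z Dz _; exact: cvg0].
  have := Vub 0 D0; rewrite enorm0 expr0n mulr0 => /(_ (ltW r0)) V00.
  have := Vdec 0 D0; have := V0 _ (Dg 0 D0) => Vg0 le0.
  apply: enorm_eq0; apply/eqP; rewrite -sqrf_eq0 eq_le sqr_ge0 andbT.
  by rewrite -(pmulr_rle0 _ c0); lra.
move=> e e0; pose K := c / (c + G).
have cG0 : 0 < c + G by rewrite ltr_pwDl.
have K0 : 0 < K by rewrite divr_gt0.
have K1 : K <= 1 by rewrite ler_pdivrMr// mul1r lerDl.
(* The factor K makes G (e K)^2 smaller than c e^2. *)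
exists (Num.min r (e * K)); first by rewrite lt_min r0 mulr_gt0.
move=> z Dz; rewrite lt_min => /andP[zr zeK] [|k].
  by rewrite (lt_le_trans zeK)// ler_piMr// ltW.
rewrite -(ltr_pXn2r (n := 2)) ?nnegrE ?enorm_ge0 ?(ltW e0)//.
rewrite -(ltr_pM2l c0).
have Dk := Dit z k Dz.
have h1 : c * enorm (iter k.+1 g z) ^+ 2 <= V z.
  apply: le_trans (Vit z k Dz); apply: le_trans (Vdec _ Dk).
  by rewrite lerDr V0//; exact: Dg.
apply: (le_lt_trans h1); apply: (le_lt_trans (Vub z Dz (ltW zr))).
apply: (@le_lt_trans _ _ (G * (e * K) ^+ 2)).
  rewrite ler_wpM2l// lerXn2r ?nnegrE ?enorm_ge0 ?(ltW zeK)//.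
  by rewrite mulr_ge0// ltW.
have GK : G * K < c by rewrite mulrA ltr_pdivrMr//; nra.
rewrite exprMn mulrCA [ltRHS]mulrC ltr_pM2l ?exprn_gt0//.
rewrite expr2 mulrA; apply: le_lt_trans GK.
by rewrite ler_piMr// mulr_ge0// ltW.
Qed.

(** * Receding-horizon control *)

Definition stage_cost (R : realType) (n m : nat) (Q : 'M[R]_n) (Rw : 'M[R]_m)
    (x : 'cV[R]_n) (u : 'cV[R]_m) : R :=
  qform Q x + qform Rw u.

(** The decrease condition makes the terminal weight P an upper bound on the
    cost to go under the terminal controller kf. *)
Definition terminal_ingredients (R : realType) (n m : nat)
    (f : 'cV[R]_n -> 'cV[R]_m -> 'cV[R]_n)
    (X : set 'cV[R]_n) (U : set 'cV[R]_m) (Xf : set 'cV[R]_n)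
    (Q : 'M[R]_n) (Rw : 'M[R]_m) (P : 'M[R]_n)
    (kf : 'cV[R]_n -> 'cV[R]_m) : Prop :=
  [/\ Xf `<=` X,
      forall x, Xf x -> U (kf x),
      forall x, Xf x -> Xf (f x (kf x))
    & forall x, Xf x ->
        qform P (f x (kf x)) + stage_cost Q Rw x (kf x) <= qform P x].

(** The usual candidate after one step of the closed loop, built from the
    sequence v used before the step.  Inputs being numbered from 1 to l - 1, the
    terminal control at x_l takes the place l - 1. *)
Definition shifted_input (R : realType) (n m : nat)
    (f : 'cV[R]_n -> 'cV[R]_m -> 'cV[R]_n) (kf : 'cV[R]_n -> 'cV[R]_m)
    (l : nat) (x : 'cV[R]_n) (u : 'cV[R]_m) (v : nat -> 'cV[R]_m) (i : nat) :
    'cV[R]_m :=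
  if (i.+1 < l)%N then v i.+1 else kf (pred_state f x u v l).

(** Input j acts on the predicted state x_j, which is j - 1 terminal steps
    after x_1 = f x u: hence the predecessor. *)
Definition terminal_rollout (R : realType) (n m : nat)
    (f : 'cV[R]_n -> 'cV[R]_m -> 'cV[R]_n) (kf : 'cV[R]_n -> 'cV[R]_m)
    (x : 'cV[R]_n) (u : 'cV[R]_m) (i : nat) : 'cV[R]_m :=
  kf (iter i.-1 (fun y => f y (kf y)) (f x u)).

Definition ocp_value (R : realType) (n m : nat)
    (f : 'cV[R]_n -> 'cV[R]_m -> 'cV[R]_n)
    (X : set 'cV[R]_n) (U : set 'cV[R]_m) (Xf : set 'cV[R]_n)
    (Q : 'M[R]_n) (Rw : 'M[R]_m) (P : 'M[R]_n) (l : nat)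
    (x : 'cV[R]_n) (u : 'cV[R]_m) : R :=
  inf [set ocp_cost f Q Rw P l x u v | v in ocp_feasible f X U Xf l x u].

Section RecedingHorizon.

Variables (R : realType) (n m l : nat).
Variables (f : 'cV[R]_n -> 'cV[R]_m -> 'cV[R]_n).
Variables (X : set 'cV[R]_n) (U : set 'cV[R]_m) (Xf : set 'cV[R]_n).
Variables (Q : 'M[R]_n) (Rw : 'M[R]_m) (P : 'M[R]_n).
Variable kf : 'cV[R]_n -> 'cV[R]_m.

Hypothesis l_ge2 : (2 <= l)%N.
Hypotheses (Q_posdef : posdef Q) (Rw_posdef : posdef Rw) (P_posdef : posdef P).
Hypothesis kf_terminal : terminal_ingredients f X U Xf Q Rw P kf.

Implicit Types (x : 'cV[R]_n) (u : 'cV[R]_m) (v : nat -> 'cV[R]_m).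

Local Notation feasible := (ocp_feasible f X U Xf l).
Local Notation cost := (ocp_cost f Q Rw P l).
Local Notation value := (ocp_value f X U Xf Q Rw P l).
Local Notation stage := (stage_cost Q Rw).

Lemma stage_ge0 x u : 0 <= stage x u.
Proof. by rewrite addr_ge0// posdef_qform_ge0. Qed.

Lemma ocp_cost_ge0 x u v : 0 <= cost x u v.
Proof.
by rewrite addr_ge0// mulr_ge0 ?posdef_qform_ge0 ?sumr_ge0// => i _;
  exact: stage_ge0.
Qed.

Lemma ocp_value_le x u v : feasible x u v -> value x u <= cost x u v.
Proof.
move=> fv; apply: ge_inf; last by exists v.
by exists 0 => _ [w _ <-]; exact: ocp_cost_ge0.
Qed.

Lemma ocp_value_minimizer x u v :
  ocp_minimizer f X U Xf Q Rw P l x u v -> value x u = cost x u v.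
Proof.
case=> fv minv; apply/eqP; rewrite eq_le ocp_value_le//=.
apply: lb_le_inf; first by exists (cost x u v), v.
by move=> _ [w fw <-]; exact: minv.
Qed.

Lemma feasible_set_ocp z v :
  feasible (usubmx z) (dsubmx z) v -> feasible_set f X U Xf l z.
Proof.
case=> Xv Uv Xfv; exists v; split=> // j /andP[j1 jl].
by apply: Xv; rewrite j1 ltnW.
Qed.

Lemma pred_state_shifted x u v j : (j < l)%N ->
  pred_state f (f x u) (v 1%N) (shifted_input f kf l x u v) j
    = pred_state f x u v j.+1.
Proof.
elim: j => [//|j IH] jl; rewrite [LHS]/= (IH (ltnW jl)); case: j {IH} jl => [//|j] jl.
by rewrite /shifted_input jl.
Qed.

Lemma pred_state_shifted_last x u v (y := pred_state f x u v l) :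
  pred_state f (f x u) (v 1%N) (shifted_input f kf l x u v) l = f y (kf y).
Proof.
rewrite {}/y; move: pred_state_shifted l_ge2.
case: l => [//|[//|k]] /(_ x u v k.+1 (ltnSn _)) Ek _.
by rewrite [LHS]/= -/(pred_state f _ _ _ k.+1) Ek /shifted_input ltnn.
Qed.

Lemma shifted_feasible x u v :
  feasible x u v -> feasible (f x u) (v 1%N) (shifted_input f kf l x u v).
Proof.
case: kf_terminal => XfX Ukf Xfkf _ [Xv Uv Xfv].
split=> [j /andP[j1]|j /andP[j1 jl]|].
- rewrite leq_eqVlt => /orP[/eqP->|jl].
    by rewrite pred_state_shifted_last; exact/XfX/Xfkf.
  by rewrite pred_state_shifted//; exact: Xv.
- rewrite /shifted_input; case: ifP => [jl'|_]; last exact: Ukf.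
  by apply: Uv; rewrite jl'.
- by rewrite pred_state_shifted_last; exact: Xfkf.
Qed.

(** Shifting drops the first stage and appends a terminal one, whose cost is
    paid for by the decrease of the terminal cost. *)
Lemma shifted_cost x u v : feasible x u v ->
  cost (f x u) (v 1%N) (shifted_input f kf l x u v)
    + 2^-1 * stage (f x u) (v 1%N) <= cost x u v.
Proof.
case: kf_terminal => _ _ _ Pdec [_ _ Xfv].
have := Pdec _ Xfv; rewrite /ocp_cost pred_state_shifted_last.
set y := pred_state f x u v l; set w := shifted_input _ _ _ _ _ _.
set S' := \sum_(1 <= j < l) _; set S := \sum_(1 <= j < l) _ => ydec.
suff : S' + stage (f x u) (v 1%N) = S + stage y (kf y) by lra.
(* Both sides are the sum over 1 <= j <= l of the stages along v completed. *)
pose h j := stage (pred_state f x u v j) (if (j < l)%N then v j else kf y).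
have -> : S' = \sum_(1 <= j < l) h j.+1.
  by apply: eq_big_nat => j /andP[_ jl]; rewrite pred_state_shifted.
have -> : S = \sum_(1 <= j < l) h j.
  by apply: eq_big_nat => j /andP[_ jl]; rewrite /h jl.
have -> : stage (f x u) (v 1%N) = h 1%N by rewrite /h l_ge2.
have -> : stage y (kf y) = h l by rewrite /h ltnn.
by rewrite addrC -big_nat_recl ?big_nat_recr// ltnW.
Qed.

Lemma pred_state_rollout x u j :
  pred_state f x u (terminal_rollout f kf x u) j.+1
    = iter j (fun y => f y (kf y)) (f x u).
Proof.
by elim: j => [//|j IH]; rewrite iterS -IH [LHS]/= /terminal_rollout/= -IH.
Qed.

Lemma pred_state_rollout_terminal x u j : Xf (f x u) -> (0 < j)%N ->
  Xf (pred_state f x u (terminal_rollout f kf x u) j).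
Proof.
case: kf_terminal => _ _ Xfkf _ Xfx; case: j => // j _.
by rewrite pred_state_rollout; elim: j => //= j; exact: Xfkf.
Qed.

Lemma terminal_rolloutE x u j : (0 < j)%N ->
  terminal_rollout f kf x u j
    = kf (pred_state f x u (terminal_rollout f kf x u) j).
Proof. by case: j => // j _; rewrite pred_state_rollout. Qed.

Lemma terminal_rollout_feasible x u : Xf (f x u) ->
  feasible x u (terminal_rollout f kf x u).
Proof.
case: kf_terminal => XfX Ukf _ _ Xfx.
split=> [j /andP[j1 _]|j /andP[j1 _]|].
- exact/XfX/pred_state_rollout_terminal.
- by rewrite terminal_rolloutE//; exact/Ukf/pred_state_rollout_terminal.
- by apply: pred_state_rollout_terminal => //; exact: ltnW.
Qed.

(** Along the terminal controller the decrease of P telescopes. *)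
Lemma terminal_rollout_cost x u : Xf (f x u) ->
  cost x u (terminal_rollout f kf x u) <= 2^-1 * qform P (f x u).
Proof.
move=> Xfx; case: kf_terminal => _ _ _ Pdec; rewrite /ocp_cost.
set v := terminal_rollout f kf x u; set y := pred_state f x u v.
suff : \sum_(1 <= j < l) stage (y j) (v j) <= qform P (f x u) - qform P (y l).
  by rewrite /stage_cost => ?; lra.
have -> : qform P (f x u) - qform P (y l)
    = \sum_(1 <= j < l) (- qform P (y j.+1) - - qform P (y j)).
  by rewrite (telescope_sumr (fun j => - qform P (y j))) 1?ltnW// opprK addrC.
apply: ler_sum_nat => j /andP[j1 jl]; rewrite opprK.
have := Pdec _ (pred_state_rollout_terminal Xfx j1).
rewrite -terminal_rolloutE// -/v -/(y j).
have -> : f (y j) (v j) = y j.+1 by case: j j1 {jl}.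
by lra.
Qed.

End RecedingHorizon.

(** * The closed loop *)

(** Boundedness of A and B makes f grow at most linearly, so the terminal cost
    of the next state grows at most quadratically. *)
Lemma qform_quasilinear_ub (R : realType) (n m : nat)
    (A : 'cV[R]_n -> 'cV[R]_m -> 'M[R]_n)
    (B : 'cV[R]_n -> 'cV[R]_m -> 'M[R]_(n, m)) (P : 'M[R]_n) (a b : R) :
  (forall x u, opnorm (A x u) <= a) -> (forall x u, opnorm (B x u) <= b) ->
  exists2 G : R, 0 < G & forall z : 'cV[R]_(n + m),
    qform P (quasilinear A B (usubmx z) (dsubmx z)) <= G * enorm z ^+ 2.
Proof.
move=> Aa Bb; pose s := \sum_i \sum_j `|P i j|.
have s0 : 0 <= s by rewrite sumr_ge0// => i _; rewrite sumr_ge0.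
have le_stack (p q r : R) : 0 <= p -> 0 <= r -> r ^+ 2 = p ^+ 2 + q ^+ 2 -> p <= r.
  move=> p0 r0 E; rewrite -(ler_pXn2r (n := 2)) ?nnegrE// E.
  by rewrite lerDl sqr_ge0.
have mulmx_le p (M : 'M[R]_(n, p)) (x : 'cV[R]_p) (c e : R) :
    opnorm M <= c -> enorm x <= e -> enorm (M *m x) <= `|c| * e.
  move=> Mc xe; apply: (le_trans (enorm_mulmx_opnorm _ _)).
  apply: (@le_trans _ _ (`|c| * enorm x)); last by rewrite ler_wpM2l.
  by rewrite ler_wpM2r ?enorm_ge0// (le_trans Mc)// ler_norm.
exists ((s + 1) * (`|a| + `|b| + 1) ^+ 2).
  by rewrite mulr_gt0 ?exprn_gt0 ?ltr_wpDl.
move=> z; rewrite -mulrA -exprMn.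
apply: le_trans (_ : s * ((`|a| + `|b| + 1) * enorm z) ^+ 2 <= _); last first.
  by rewrite ler_wpM2r ?sqr_ge0// lerDl.
apply: qform_ub => i; have E := sqr_enorm_stack z.
rewrite mxE; apply: (le_trans (ler_normD _ _)).
have hx : enorm (usubmx z) <= enorm z by apply: le_stack E; exact: enorm_ge0.
have hu : enorm (dsubmx z) <= enorm z.
  by apply: (@le_stack _ (enorm (usubmx z))); rewrite ?enorm_ge0// E addrC.
have hA := le_trans (coord_le_enorm _ i) (mulmx_le _ _ _ _ _ (Aa _ _) hx).
have hB := le_trans (coord_le_enorm _ i) (mulmx_le _ _ _ _ _ (Bb _ _) hu).
apply: (le_trans (lerD (hA _ _) (hB _ _))).
by rewrite -mulrDl ler_wpM2r ?enorm_ge0// lerDl.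
Qed.

Theorem theorem2 (R : realType) (n m l : nat)
    (A : 'cV[R]_n -> 'cV[R]_m -> 'M[R]_n)
    (B : 'cV[R]_n -> 'cV[R]_m -> 'M[R]_(n, m))
    (X : set 'cV[R]_n) (U : set 'cV[R]_m)
    (Q : 'M[R]_n) (Rw : 'M[R]_m) (P : 'M[R]_n) (alpha : R)
    (kappa_mpc : 'cV[R]_(n + m) -> 'cV[R]_m) :
  let f := quasilinear A B in
  let A0 := A 0 0 in
  let B0 := B 0 0 in
  let kappa_f := fun x : 'cV[R]_n => lqr_gain A0 B0 Rw P *m x in
  let Vf := qform P in
  let Xf := ellipsoid P alpha in
  let F_l := feasible_set f X U Xf l in
  (2 <= l)%N ->
  closed X -> closed U ->
  posdef Q -> posdef Rw ->
  (* (A1) *)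
  continuously_differentiable
    (fun z : 'cV[R]_n * 'cV[R]_m => A z.1 z.2) ->
  continuously_differentiable
    (fun z : 'cV[R]_n * 'cV[R]_m => B z.1 z.2) ->
  (exists2 LA : R, 0 < LA & forall x x' u u',
     opnorm (A x u - A x' u') <= LA * (enorm (x - x') + enorm (u - u'))) ->
  (exists2 LB : R, 0 < LB & forall x x' u u',
     opnorm (B x u - B x' u') <= LB * (enorm (x - x') + enorm (u - u'))) ->
  (* (A2) *)
  (exists2 a : R, 0 < a & forall x u, opnorm (A x u) <= a) ->
  (exists2 b : R, 0 < b & forall x u, opnorm (B x u) <= b) ->
  (* (A3) *)
  stabilizable A0 B0 ->
  detectable A0 (mxsqrt Q) ->
  interior X 0 -> interior U 0 ->
  (* terminal ingredients *)
  stabilizing_solution A0 B0 Q Rw P ->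
  0 < alpha ->
  Xf `<=` X ->
  (forall x, Xf x -> U (kappa_f x)) ->
  (forall x, Xf x -> Xf (f x (kappa_f x))) ->
  (forall x, Xf x ->
     Vf (f x (kappa_f x)) - Vf x <= - qform Q x - qform Rw (kappa_f x)) ->
  (* receding-horizon control *)
  mpc_law f X U Xf Q Rw P l kappa_mpc ->
  asymptotically_stable F_l (closed_loop f kappa_mpc) /\
  (forall z0, F_l z0 ->
     iter k (closed_loop f kappa_mpc) z0 @[k --> \oo]
       --> (0 : 'cV[R]_(n + m))).
Proof.
move=> f A0 B0 kf Vf Xf F_l l2 _ _ Qpd Rpd _ _ _ _ [a a0 Aa] [b b0 Bb] _ _ _ _.
move=> [Ppd _ _] alpha0 XfX Ukf Xfkf Pdec kappaP.
have kf_terminal : terminal_ingredients f X U Xf Q Rw P kf.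
  split=> // x /Pdec; rewrite /stage_cost /Vf -/f; lra.
have [cQ cQ0 cQ_le] := posdef_qform_lb Qpd.
have [cR cR0 cR_le] := posdef_qform_lb Rpd.
have [G G0 G_le] := qform_quasilinear_ub P Aa Bb.
pose V (z : 'cV[R]_(n + m)) :=
  ocp_value f X U Xf Q Rw P l (usubmx z) (dsubmx z).
(* 1/2 is the weight of a stage in the cost. *)
pose c := 2^-1 * Num.min cQ cR.
have c_le (x : 'cV[R]_n) (u : 'cV[R]_m) :
    c * enorm (col_mx x u) ^+ 2 <= 2^-1 * stage_cost Q Rw x u.
  rewrite -mulrA ler_pM2l ?invr_gt0// sqr_enorm_stack col_mxKu col_mxKd mulrDr.
  apply: lerD; [apply: le_trans (cQ_le x)|apply: le_trans (cR_le u)];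
    by rewrite ler_wpM2r ?sqr_ge0// ge_min lexx ?orbT.
(* The bound 1 gives |z|^2 <= |z|, so that |z| <= alpha / G suffices. *)
pose r := Num.min 1 (alpha / G).
have r0 : 0 < r by rewrite lt_min ltr01 divr_gt0.
have near_terminal z : enorm z <= r -> Xf (f (usubmx z) (dsubmx z)).
  rewrite le_min => /andP[z1 zr]; apply: (le_trans (G_le z)).
  rewrite mulrC -ler_pdivlMr//; apply: le_trans zr.
  by rewrite expr2 ler_piMr// enorm_ge0.
apply: (@lyapunov_stability _ _ _ _ V c G r) => //.
- by rewrite mulr_gt0 ?invr_gt0// lt_min cQ0.
- exact: ltW.
- apply: (feasible_set_ocp (terminal_rollout_feasible l2 kf_terminal _)).
  by apply: near_terminal; rewrite enorm0 ltW.
- move=> z /kappaP[v [fv _] kv]; rewrite /closed_loop kv.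
  apply: feasible_set_ocp; rewrite col_mxKu col_mxKd.
  exact: (shifted_feasible l2 kf_terminal fv).
- move=> z /kappaP[v vmin _]; rewrite /V (ocp_value_minimizer Qpd Rpd Ppd vmin).
  exact: ocp_cost_ge0.
- move=> z /kappaP[v vmin kv]; rewrite /V (ocp_value_minimizer Qpd Rpd Ppd vmin).
  have [fv _] := vmin; rewrite /closed_loop kv col_mxKu col_mxKd.
  apply: le_trans (shifted_cost l2 kf_terminal fv); apply: lerD (c_le _ _).
  exact: (ocp_value_le Qpd Rpd Ppd (shifted_feasible l2 kf_terminal fv)).
- move=> z _ /near_terminal Xfz.
  have fw := terminal_rollout_feasible l2 kf_terminal Xfz.
  apply: (le_trans (ocp_value_le Qpd Rpd Ppd fw)).
  apply: (le_trans (terminal_rollout_cost l2 kf_terminal Xfz)).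
  apply: le_trans (G_le z); rewrite ler_piMl ?posdef_qform_ge0//.
  by rewrite invf_le1 ?ler1n.
Qed.
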